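(* Let $p \geq 2$ and $k \geq 2$ be integers. For $n\ge 0$, let $d_{pk}(n)$ be the number of partitions of $n$ in which exactly one part appears at least $pk$ times (all other parts appear at most $pk-1$ times), and let $d_{p}(n,k,0)$ be the number of partitions of $n$ in which exactly one part divisible by $p$ appears at least $k$ times (every other part divisible by $p$ appears at most $k-1$ times), while parts not divisible by $p$ appear with unrestricted multiplicity. Then for all $n \geq 0$, $$d_{pk}(n) = d_{p}(n,k,0).$$ *)

(* Defs.v *)
From HB Require Import structures.
From mathcomp Require Import all_boot.

Set Implicit Arguments.
Unset Strict Implicit.
Unset Printing Implicit Defensive.

Definition is_intpart (n : nat) (s : seq nat) : bool :=
  [&& sorted geq s, 0 \notin s & sumn s == n].

Record intpart (n : nat) : Type :=
  IntPart { parts :> seq nat; partsP : is_intpart n parts }.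

HB.instance Definition _ n := [isSub for @parts n].
HB.instance Definition _ n := [Countable of intpart n by <:].

Lemma mem_leq_sumn (s : seq nat) x : x \in s -> x <= sumn s.
Proof.
elim: s => //= y s IHs; rewrite inE => /orP[/eqP->|/IHs le_x].
  exact: leq_addr.
exact: leq_trans le_x (leq_addl _ _).
Qed.

Lemma size_leq_sumn (s : seq nat) : 0 \notin s -> size s <= sumn s.
Proof.
elim: s => //= y s IHs; rewrite inE negb_or eq_sym -lt0n => /andP[y_gt0 /IHs].
by rewrite -add1n; apply: leq_add.
Qed.

(* A partition of n has at most n parts, each at most n, so that intpart n
   embeds into a finite type; this is used only to make it a finType. *)
Definition intpart_code n (l : intpart n) : n.-bseq 'I_n.+1 :=
  insub_bseq n (map inord (parts l)).

Definition intpart_decode n (b : n.-bseq 'I_n.+1) : option (intpart n) :=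
  insub (map val b).

Lemma intpart_codeK n : pcancel (@intpart_code n) (@intpart_decode n).
Proof.
move=> l; have /and3P[_ l_gt0 /eqP l_sum] := partsP l.
have sz_l : size (map (@inord n) l) <= n.
  by rewrite size_map (leq_trans (size_leq_sumn l_gt0)) ?l_sum.
suff code_l : map val (intpart_code l) = parts l.
  by rewrite /intpart_decode code_l valK.
rewrite val_insubd sz_l -map_comp.
rewrite -[RHS]map_id; apply/eq_in_map => x /mem_leq_sumn.
by rewrite l_sum => le_xn; rewrite /= inordK.
Qed.

HB.instance Definition _ n : isFinite (intpart n) :=
  PCanIsFinite (@intpart_codeK n).

(* Number of distinct values (hence undup) that satisfy P and occur at least
   m times in s. *)
Definition num_repeated (P : pred nat) (m : nat) (s : seq nat) : nat :=
  count [pred x | P x && (m <= count_mem x s)] (undup s).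

Definition d_mult (m n : nat) : nat :=
  #|[set l : intpart n | num_repeated predT m l == 1]|.

Definition d_dvd (p n k : nat) : nat :=
  #|[set l : intpart n | num_repeated (dvdn p) k l == 1]|.

(* Main.v *)
(* Fix [a] and [b] and split a partition [l] as [l'] plus [b] copies of [a * s],
   where [i] occurs [count_mem (a * i) l %/ b] times in [s]: the parts divisible
   by [a] that occur at least [b] times in [l] match the distinct parts of [s],
   no such part is left in [l'], and [l'] and [s] can be chosen independently
   subject to [|l| = |l'| + a * b * |s|].  Counting all partitions this way
   determines the number of possible [l'] recursively, so it depends only on
   [a * b]; hence so does the number of [l] with a prescribed number of repeated
   parts.  The two sides of the theorem are [(a, b) = (1, p * k)] and
   [(a, b) = (p, k)]. *)
Require Import Defs.
From mathcomp Require Import all_boot.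

Definition dilate (a b : nat) (s : seq nat) : seq nat :=
  flatten (nseq b (map (muln a) s)).

(** This is the [s] of the splitting above. Sorting makes it canonical, so that matching it with a
    partition is plain equality of lists. *)
Definition quot (a b : nat) (l : seq nat) : seq nat :=
  sort geq (flatten [seq nseq (count_mem x l %/ b) (x %/ a)
                    | x <- undup l & a %| x]).

Lemma sorted_geq_eq (s t : seq nat) :
  sorted geq s -> sorted geq t -> perm_eq s t -> s = t.
Proof.
apply: sorted_eq => [x y z le_xy le_zx | x y /andP[le_yx le_xy]].
  exact: leq_trans le_zx le_xy.
by apply/eqP; rewrite eqn_leq; apply/andP.
Qed.

Lemma geq_total : total geq.
Proof. by move=> x y; apply: leq_total. Qed.

Lemma quot_sorted a b l : sorted geq (quot a b l).
Proof. exact: sort_sorted geq_total _. Qed.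

Lemma count_quot a b l i :
  0 < a -> count_mem i (quot a b l) = count_mem (a * i) l %/ b.
Proof.
move=> a_gt0; rewrite /quot (permP (permEl (perm_sort geq _))).
rewrite count_flatten -map_comp sumnE big_map big_filter.
have cE x : a %| x -> count_mem i (nseq (count_mem x l %/ b) (x %/ a)) =
    if x == a * i then count_mem (a * i) l %/ b else 0.
  move=> /dvdnP[q ->]; rewrite count_nseq mulnK //= (mulnC q) eqn_pmul2l //.
  by case: eqP => [->|_]; rewrite ?mul1n.
rewrite (eq_bigr _ cE) -big_mkcondr /=.
rewrite (eq_bigl (pred1 (a * i))); last first.
  by move=> x /=; case: eqP => [->|]; rewrite ?andbF // dvdn_mulr.
rewrite big_const_seq iter_addn_0 count_uniq_mem ?undup_uniq // mem_undup.
by case: (boolP (_ \in l)) => [_|/count_memPn->]; rewrite ?muln1 ?div0n.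
Qed.

Lemma count_dilate_dvd a b s i :
  0 < a -> count_mem (a * i) (dilate a b s) = b * count_mem i s.
Proof.
move=> a_gt0; rewrite /dilate count_flatten map_nseq sumn_nseq count_map mulnC.
by congr (_ * _); apply: eq_count => x /=; rewrite eqn_pmul2l.
Qed.

Lemma count_dilate_ndvd a b s x :
  ~~ (a %| x) -> count_mem x (dilate a b s) = 0.
Proof.
move=> ndv; rewrite /dilate count_flatten map_nseq sumn_nseq.
rewrite (count_memPn _) ?mul0n //.
by apply: contra ndv => /mapP[y _ ->]; apply: dvdn_mulr.
Qed.

Lemma sumn_dilate a b s : sumn (dilate a b s) = a * b * sumn s.
Proof.
rewrite /dilate sumn_flatten map_nseq sumn_nseq mulnAC; congr (_ * _).
by rewrite !sumnE big_map -big_distrr.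
Qed.

Lemma quot_cat_dilate a b l s :
  0 < a -> 0 < b -> sorted geq s -> quot a b l = [::] ->
  quot a b (l ++ dilate a b s) = s.
Proof.
move=> a_gt0 b_gt0 s_sort l0; apply: sorted_geq_eq (quot_sorted _ _ _) s_sort _.
apply/allP => i _; apply/eqP; rewrite count_quot // count_cat count_dilate_dvd //.
(* The multiplicity [c] of [a * i] in [l] satisfies [c %/ b = 0] by [l0], so the added multiple of
   [b] alone survives the division. *)
by rewrite [b * _]mulnC divnDMl // -count_quot // l0.
Qed.

Lemma eq_quot a b l1 l2 : 0 < a -> perm_eq l1 l2 -> quot a b l1 = quot a b l2.
Proof.
move=> a_gt0 /permP eq_l; apply: sorted_geq_eq; try exact: quot_sorted.
by apply/allP => i _; apply/eqP; rewrite !count_quot // eq_l.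
Qed.

(** If a multiple of [a] occurs [c] times in [l], then [c %/ b * b] copies are removed and
    [c %% b < b] remain. Other parts are untouched. *)
Lemma quot_decomp a b l :
  0 < a -> 0 < b -> exists2 l', perm_eq l (l' ++ dilate a b (quot a b l))
                              & quot a b l' = [::].
Proof.
move=> a_gt0 b_gt0.
have /count_subseqP[s sub_s eq_s] :
    forall x, count_mem x (dilate a b (quot a b l)) <= count_mem x l.
  move=> x; have [/dvdnP[i ->]|ndv] := boolP (a %| x); last first.
    by rewrite count_dilate_ndvd.
  by rewrite mulnC count_dilate_dvd // count_quot // mulnC leq_divM.
have [l' eq_l] := perm_to_subseq sub_s.
have {}eq_l : perm_eq l (l' ++ dilate a b (quot a b l)).
  by apply: perm_trans eq_l _; rewrite perm_catC perm_cat2l perm_sym.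
exists l' => //; apply: sorted_geq_eq; [exact: quot_sorted | by [] |].
apply/allP => i _; apply/eqP; rewrite count_quot //=.
have /permP/(_ (pred1 (a * i))) := eq_l.
rewrite count_cat count_dilate_dvd // count_quot // => /(congr1 (divn^~ b)).
(* With [c] and [c'] the multiplicities in [l] and [l'], dividing by [b] gives
   [c %/ b = c' %/ b + c %/ b], whence [c' %/ b = 0]. *)
by rewrite [b * _]mulnC divnDMl // -{1}[_ %/ b]add0n => /addIn.
Qed.

Lemma sum_quot_leq a b l : 0 < a -> 0 < b -> a * b * sumn (quot a b l) <= sumn l.
Proof.
move=> a_gt0 b_gt0; have [l' /perm_sumn-> _] := quot_decomp a b l a_gt0 b_gt0.
by rewrite sumn_cat sumn_dilate leq_addl.
Qed.

Lemma quot_is_intpart a b n (l : intpart n) :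
  0 < a -> is_intpart (sumn (quot a b l)) (quot a b l).
Proof.
move=> a_gt0; have /and3P[_ l_gt0 _] := partsP l.
rewrite /is_intpart quot_sorted eqxx andbT /=; apply/count_memPn.
by rewrite count_quot // muln0 (count_memPn l_gt0) div0n.
Qed.

(** Multiplication by [a] is injective and carries the distinct parts of the quotient onto the parts
    being counted, because [0 < c %/ b] exactly when [b <= c]. *)
Lemma num_repeated_quot a b l :
  0 < a -> 0 < b -> num_repeated (dvdn a) b l = size (undup (quot a b l)).
Proof.
move=> a_gt0 b_gt0; rewrite /num_repeated -size_filter.
rewrite -(size_map (muln a) (undup _)); apply/perm_size/uniq_perm.
- by rewrite filter_uniq ?undup_uniq.
- by rewrite map_inj_uniq ?undup_uniq // => x y /eqP; rewrite eqn_pmul2l // => /eqP.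
move=> x; rewrite mem_filter mem_undup /=; have [/dvdnP[i ->]|ndv] /= := boolP (a %| x).
  rewrite mulnC mem_map => [|y z /eqP]; last by rewrite eqn_pmul2l // => /eqP.
  rewrite mem_undup -!has_pred1 !has_count count_quot // divn_gt0 //.
  by apply: andb_idr; apply: leq_trans.
by apply/esym/negP => /mapP[y _ xE]; rewrite xE dvdn_mulr in ndv.
Qed.

Lemma adjoin_subproof a b m n (s : intpart m) (l : intpart n) :
  0 < a -> is_intpart (a * b * m + n) (sort geq (l ++ dilate a b s)).
Proof.
move=> a_gt0; have /and3P[_ s_gt0 /eqP s_sum] := partsP s.
have /and3P[_ l_gt0 /eqP l_sum] := partsP l.
have eq_l := permEl (perm_sort geq (l ++ dilate a b s)).
rewrite /is_intpart (sort_sorted geq_total) /= (perm_mem eq_l) (perm_sumn eq_l).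
rewrite sumn_cat sumn_dilate s_sum l_sum addnC eqxx andbT.
rewrite mem_cat (negPf l_gt0) /=; apply/count_memPn.
by rewrite -{1}(muln0 a) count_dilate_dvd // (count_memPn s_gt0) muln0.
Qed.

Definition adjoin a b m n (s : intpart m) (a_gt0 : 0 < a) (l : intpart n) :
  intpart (a * b * m + n) := IntPart (adjoin_subproof a b m n s l a_gt0).

Definition num_quot_nil (a b n : nat) : nat :=
  #|[set l : intpart n | quot a b l == [::]]|.

(** [adjoin] with [s] fixed is a bijection from the partitions with empty quotient onto this fibre;
    [quot_decomp] gives surjectivity. *)
Lemma card_quot_fiber a b m n (s : intpart m) : 0 < a -> 0 < b ->
  #|[set l : intpart n | quot a b l == s :> seq nat]|
  = if a * b * m <= n then num_quot_nil a b (n - a * b * m) else 0.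
Proof.
move=> a_gt0 b_gt0; have /and3P[s_sort s_gt0 /eqP s_sum] := partsP s.
case: leqP => [le_n | lt_n]; last first.
  apply: eq_card0 => l; rewrite inE; apply: contraTF lt_n => /eqP quot_l.
  have /and3P[_ _ /eqP l_sum] := partsP l.
  by rewrite -leqNgt -s_sum -quot_l -[leqRHS]l_sum sum_quot_leq.
move: (subnKC le_n); move: (n - _) => {le_n}n' <-; move: n' => {}n.
have sort_l (l : seq nat) := permEl (perm_sort geq (l ++ dilate a b s)).
rewrite /num_quot_nil -(card_imset _ (f := adjoin a b m n s a_gt0)); last first.
  move=> l1 l2 /(congr1 (@parts _)) /= eq_l; apply: val_inj => /=.
  have /and3P[l1_sort _ _] := partsP l1; have /and3P[l2_sort _ _] := partsP l2.
  apply: sorted_geq_eq => //; rewrite -(perm_cat2r (dilate a b s)).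
  by rewrite -(permPl (sort_l l1)) eq_l.
apply: eq_card => l; rewrite inE; apply/eqP/imsetP => [quot_l | [l']]; last first.
  rewrite inE => /eqP quot_l' ->.
  by rewrite (eq_quot _ _ _ _ a_gt0 (sort_l l')) quot_cat_dilate.
have [r eq_r r0] := quot_decomp a b l a_gt0 b_gt0; rewrite quot_l in eq_r.
have /and3P[l_sort l_gt0 /eqP l_sum] := partsP l.
have eq_r' := permEl (perm_sort geq r).
have r_part : is_intpart n (sort geq r).
  rewrite /is_intpart (sort_sorted geq_total) (perm_mem eq_r') (perm_sumn eq_r') /=.
  move: l_gt0; rewrite (perm_mem eq_r) mem_cat => /norP[-> _] /=.
  move: l_sum; rewrite (perm_sumn eq_r) sumn_cat sumn_dilate s_sum addnC.
  by move/addnI->.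
exists (IntPart r_part); first by rewrite inE (eq_quot _ _ _ _ a_gt0 eq_r') r0.
apply: val_inj; apply: sorted_geq_eq => //=; first exact: sort_sorted geq_total _.
rewrite (permPl eq_r) perm_sym (permPl (sort_l _)) perm_cat2r.
exact: eq_r'.
Qed.

Lemma card_quot_pred a b n (Q : pred (seq nat)) : 0 < a -> 0 < b ->
  #|[set l : intpart n | Q (quot a b l)]|
  = \sum_(m < n.+1) \sum_(s : intpart m | Q s)
      if a * b * m <= n then num_quot_nil a b (n - a * b * m) else 0.
Proof.
move=> a_gt0 b_gt0.
(* For a given [l], [fib m l] vanishes unless [m] is the sum of the quotient, where it is the
   indicator of [Q (quot a b l)]. *)
pose fib m (l : intpart n) : nat := \sum_(s : intpart m | Q s) (quot a b l == s).
transitivity (\sum_(m < n.+1) \sum_(l : intpart n) fib m l); last first.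
  apply: eq_bigr => m _; rewrite exchange_big; apply: eq_bigr => s _.
  rewrite -(card_quot_fiber _ _ _ _ s) // -sum1dep_card [RHS]big_mkcond.
  by apply: eq_bigr => l _; case: eqP.
rewrite exchange_big -sum1dep_card big_mkcond; apply: eq_bigr => l _ /=.
have /and3P[_ _ /eqP l_sum] := partsP l.
have lt_m : sumn (quot a b l) < n.+1.
  rewrite ltnS -[leqRHS]l_sum; apply: leq_trans (sum_quot_leq a b l a_gt0 b_gt0).
  by rewrite leq_pmull // muln_gt0 a_gt0.
rewrite (bigD1 (Ordinal lt_m)) //= [X in _ + X]big1 ?addn0 => [|m m_neq]; last first.
  apply: big1 => s _; case: eqP => // quot_l; case/eqP: m_neq; apply: val_inj => /=.
  by have /and3P[_ _ /eqP <-] := partsP s; rewrite quot_l.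
pose t := IntPart (quot_is_intpart a b n l a_gt0).
rewrite /fib big_mkcond (bigD1 t) //= eqxx big1 ?addn0 // => s s_neq.
by case: eqP => [quot_l|]; [case/eqP: s_neq; apply: val_inj | case: (Q s)].
Qed.

Lemma intpart0_nil (l : intpart 0) : l = [::] :> seq nat.
Proof.
have /and3P[_ /size_leq_sumn le_l /eqP l_sum] := partsP l.
by apply/nilP; rewrite /nilp -leqn0 -[leqRHS]l_sum.
Qed.

(** Strong induction on [n]: subtract from all partitions those with nonempty quotient, which
    [card_quot_pred] expresses by values of [num_quot_nil] at smaller arguments. *)
Lemma num_quot_nil_mul a b c d n : 0 < a -> 0 < b -> 0 < c -> 0 < d ->
  a * b = c * d -> num_quot_nil a b n = num_quot_nil c d n.
Proof.
move=> a_gt0 b_gt0 c_gt0 d_gt0 eq_ab; elim/ltn_ind: n => n IHn.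
have numC e f : num_quot_nil e f n
    = #|{: intpart n}| - #|[set l : intpart n | quot e f l != [::]]|.
  have -> : [set l : intpart n | quot e f l != [::]]
      = ~: [set l : intpart n | quot e f l == [::]].
    by apply/setP => l; rewrite !inE.
  by rewrite -(cardsC [set l : intpart n | quot e f l == [::]]) addnK.
rewrite !numC; congr (_ - _).
rewrite !(card_quot_pred _ _ n (fun s => s != [::])) // -eq_ab.
apply: eq_bigr => m _; apply: eq_bigr => s s_neq0; case: ifP => // le_n.
(* The argument strictly decreases because [m = 0] would force [s] to be empty. *)
apply: IHn; case: (m : nat) s s_neq0 le_n => [s|m' s _ le_n].
  by rewrite intpart0_nil eqxx.
have ab_gt0 : 0 < a * b * m'.+1 by rewrite !muln_gt0 a_gt0 b_gt0.
by rewrite ltn_subrL ab_gt0 (leq_trans ab_gt0).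
Qed.

(** Take [Q] in [card_quot_pred] to say that [s] has [r] distinct parts; the resulting sum involves
    [a] and [b] only through [a * b] and [num_quot_nil]. *)
Lemma card_num_repeated_mul a b c d r n :
  0 < a -> 0 < b -> 0 < c -> 0 < d -> a * b = c * d ->
  #|[set l : intpart n | num_repeated (dvdn a) b l == r]|
  = #|[set l : intpart n | num_repeated (dvdn c) d l == r]|.
Proof.
move=> a_gt0 b_gt0 c_gt0 d_gt0 eq_ab.
have cardE e f : 0 < e -> 0 < f ->
    #|[set l : intpart n | num_repeated (dvdn e) f l == r]|
    = #|[set l : intpart n | size (undup (quot e f l)) == r]|.
  by move=> e_gt0 f_gt0; apply: eq_card => l; rewrite !inE num_repeated_quot.
rewrite !cardE // !(card_quot_pred _ _ n (fun s => size (undup s) == r)) // -eq_ab.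
apply: eq_bigr => m _; apply: eq_bigr => s _; case: ifP => // _.
exact: num_quot_nil_mul.
Qed.

Theorem theorem7 (p k : nat) (hp : 2 <= p) (hk : 2 <= k) :
  forall n : nat, d_mult (p * k) n = d_dvd p n k.
Proof.
move=> n; have p_gt0 := ltnW hp; have k_gt0 := ltnW hk.
rewrite /d_dvd -(card_num_repeated_mul 1 (p * k)) ?mul1n ?muln_gt0 ?p_gt0 //.
apply: eq_card => l; rewrite !inE /num_repeated; congr (_ == _).
by apply: eq_count => x /=; rewrite dvd1n.
Qed.
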